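(* Let $\alpha,\beta$ be any real numbers and let $n$ be any positive integer. Then $$\sum_{k=1}^{n}(-\beta)^k B_{n,k}\big(0!\,\alpha,\,-1!\,\alpha^2\beta,\,\ldots,\,(-1)^{n-k}(n-k)!\,\alpha^{n-k+1}\beta^{n-k}\big)=n!\,(-\alpha\beta)^n,$$ where the $j$-th argument of $B_{n,k}$ is $(-1)^{j-1}(j-1)!\,\alpha^{j}\beta^{j-1}$ for $1\le j\le n-k+1$.
   Context: For integers $1\le k\le n$, the partial exponential Bell polynomial is $$B_{n,k}(x_1,\ldots,x_{n-k+1})=n!\sum_{\Lambda^k_n}\prod_{j=1}^{n-k+1}\frac{1}{k_j!}\Big(\frac{x_j}{j!}\Big)^{k_j},$$ where the sum is over $\Lambda^k_n=\{(k_1,\ldots,k_{n-k+1}): \sum_j k_j=k,\ \sum_j jk_j=n,\ k_j\in\mathbb{Z}_{\ge 0}\}$. The convention $0^0=1$ is used. *)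

(* Defs.v *)
From mathcomp Require Import all_boot all_order all_algebra.
From mathcomp Require Import reals.

Set Implicit Arguments.
Unset Strict Implicit.
Unset Printing Implicit Defensive.

Import Order.TTheory GRing.Theory Num.Theory.
Local Open Scope ring_scope.

(* Index sets {1, ..., n-k+1} are shifted to start at 0: the ordinal j stands
   for the index j+1.  The multiplicities k_j are bounded by k only to make the
   index set a finite type; bell_index_exhaustive shows that nothing is lost. *)
Definition bell_index (n k : nat) : {set {ffun 'I_(n - k + 1) -> 'I_k.+1}} :=
  [set m : {ffun 'I_(n - k + 1) -> 'I_k.+1} |
    (\sum_(j < n - k + 1) m j == k)%N &&
    (\sum_(j < n - k + 1) j.+1 * m j == n)%N].

Lemma bell_index_exhaustive (n k : nat) (f : 'I_(n - k + 1) -> nat) :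
  (\sum_(j < n - k + 1) f j = k)%N ->
  (\sum_(j < n - k + 1) j.+1 * f j = n)%N ->
  exists2 m, m \in bell_index n k & forall j, m j = f j :> nat.
Proof.
move=> sumk sumn.
have le_fk j : (f j < k.+1)%N by rewrite ltnS -sumk (bigD1 j) //= leq_addr.
exists [ffun j => Ordinal (le_fk j)] => [|j]; last by rewrite ffunE.
rewrite inE; apply/andP; split; apply/eqP.
  by rewrite -[RHS]sumk; apply: eq_bigr => j _; rewrite ffunE.
by rewrite -[RHS]sumn; apply: eq_bigr => j _; rewrite ffunE.
Qed.

(* Only meaningful for 1 <= k <= n. *)
Definition bell_poly (R : realType) (n k : nat)
    (x : 'I_(n - k + 1) -> R) : R :=
  n`!%:R * \sum_(m in bell_index n k)
    \prod_(j < n - k + 1)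
      (1 / (m j)`!%:R * (x j / (j.+1)`!%:R) ^+ m j).
Arguments bell_poly {R} n k x.

(* Main.v *)
Require Import Defs.
From mathcomp Require Import all_boot all_order all_algebra.
From mathcomp Require Import reals.
From mathcomp Require Import zify ring.

(** Homogeneity pulls [(- (alpha * beta)) ^+ n] out of every term of the sum, so
    that the theorem reduces to [S n = 1], where [S n] is the sum over all
    partitions of [n] of [1 / \prod_j (m_j! j ^ m_j)], with [m_j] the
    multiplicity of the part [j]; this says that [n!] counts the permutations
    by cycle type.  Writing [n = \sum_j j m_j] inside [n * S n] and removing one
    part [j] gives [n * S n = \sum_(1 <= j <= n) S (n - j)], and induction
    concludes. *)

Set Implicit Arguments.
Unset Strict Implicit.
Unset Printing Implicit Defensive.

Import Order.TTheory GRing.Theory Num.Theory.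
Local Open Scope ring_scope.

(* Truncates or extends by zero, according to the sizes; multiplicities
   exceeding [b] become [0], by the junk value of [inord]. *)
Definition resize (p a q b : nat) (m : {ffun 'I_p -> 'I_a.+1}) :
    {ffun 'I_q -> 'I_b.+1} :=
  [ffun j : 'I_q => inord (oapp (fun i => m i : nat) 0%N (insub (j : nat)))].

(** The condition under which [resize] loses nothing: [inord] never falls back to its default, and
    no nonzero multiplicity is cut off. *)
Definition fits (p a q b : nat) (m : {ffun 'I_p -> 'I_a.+1}) : Prop :=
  forall j, (0 < m j)%N -> (j < q)%N && (m j <= b)%N.

Section Resize.
Variables (p a q b : nat) (m : {ffun 'I_p -> 'I_a.+1}).
Hypothesis fits_m : fits q b m.

Lemma resizeE (j : 'I_q) :
  resize q b m j = oapp (fun i => m i : nat) 0%N (insub (j : nat)) :> nat.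
Proof.
rewrite ffunE inordK //; case: insubP => //= i _ _.
by rewrite ltnS; case: (posnP (m i)) => [-> //|/fits_m/andP[]].
Qed.

(** Since [F i 0] is neutral, both sides equal the product over [p + q] positions of the
    multiplicities extended by zero, called [f] in the proof. *)
Lemma big_resize (A : Type) (idx : A) (op : Monoid.law idx)
    (F : nat -> nat -> A) :
  (forall i, F i 0%N = idx) ->
  \big[op/idx]_(j < q) F j (resize q b m j) = \big[op/idx]_(j < p) F j (m j).
Proof.
move=> F0; pose f i := oapp (fun j => m j : nat) 0%N (insub i).
have f_out i : (p <= i)%N || (q <= i)%N -> f i = 0%N.
  rewrite /f; case: insubP => //= j _ def_i /orP[|].
    by have := ltn_ord j; lia.
  by case: (posnP (m j)) => // /fits_m/andP[]; lia.
have widen r : (p <= r)%N || (q <= r)%N -> (r <= p + q)%N ->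
    \big[op/idx]_(j < r) F j (f j) = \big[op/idx]_(j < p + q) F j (f j).
  move=> out_r le_r.
  rewrite (big_ord_widen _ (fun j => F j (f j)) le_r) big_mkcond /=.
  apply: eq_bigr => j _; case: ltnP => // le_rj; rewrite f_out ?F0 //; lia.
transitivity (\big[op/idx]_(j < q) F j (f j)).
  by apply: eq_bigr => j _; rewrite resizeE.
rewrite widen ?leqnn ?orbT ?leq_addl // -(widen p) ?leqnn ?leq_addr //.
by apply: eq_bigr => j _; rewrite /f valK.
Qed.

Lemma resizeK : resize p a (resize q b m) = m.
Proof.
apply/ffunP => j; apply: val_inj; rewrite ffunE /= inordK; last first.
  case: insubP => //= i _ def_i; rewrite resizeE def_i valK /=; exact: ltn_ord.
case: insubP => /= [i _ def_i|]; first by rewrite resizeE def_i valK.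
by rewrite -leqNgt; case: (posnP (m j)) => // /fits_m/andP[]; lia.
Qed.

End Resize.
Arguments big_resize {p a q b m} fits_m {A idx op} F F0.

Definition nparts (p a : nat) (m : {ffun 'I_p -> 'I_a.+1}) : nat :=
  \sum_(j < p) m j.

Definition weight (p a : nat) (m : {ffun 'I_p -> 'I_a.+1}) : nat :=
  \sum_(j < p) j.+1 * m j.

Lemma leq_weight (p a : nat) (m : {ffun 'I_p -> 'I_a.+1}) (j : 'I_p) :
  (j.+1 * m j <= weight m)%N.
Proof. by rewrite /weight (bigD1 j) //= leq_addr. Qed.

Lemma leq_nparts (p a : nat) (m : {ffun 'I_p -> 'I_a.+1}) (j : 'I_p) :
  (m j <= nparts m)%N.
Proof. by rewrite /nparts (bigD1 j) //= leq_addr. Qed.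

Lemma nparts_weight (p a : nat) (m : {ffun 'I_p -> 'I_a.+1}) :
  (nparts m <= weight m)%N.
Proof. by apply: leq_sum => j _; rewrite leq_pmull. Qed.

(** Besides one part [j.+1] there are [nparts m - 1] others, each at least 1. So a partition of [n]
    into [k] parts only has parts up to [n - k + 1], the range of the Bell index. *)
Lemma part_nparts_weight (p a : nat) (m : {ffun 'I_p -> 'I_a.+1}) (j : 'I_p) :
  (0 < m j)%N -> (j + nparts m <= weight m)%N.
Proof.
move=> mj_gt0; rewrite /nparts /weight (bigD1 j) //= [leqRHS](bigD1 j) //=.
rewrite addnA mulSn (addnC j); apply: leq_add.
  by rewrite leq_add2l leq_pmulr.
by apply: leq_sum => i _; rewrite leq_pmull.
Qed.

Lemma weight_eq0 (p a : nat) (m : {ffun 'I_p -> 'I_a.+1}) :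
  (weight m == 0%N) = (m == [ffun=> ord0]).
Proof.
apply/eqP/eqP => [w0|->]; last by apply: big1 => j _; rewrite ffunE muln0.
apply/ffunP => j; apply: val_inj; rewrite ffunE /=.
by have := leq_weight m j; rewrite w0; lia.
Qed.

Section CycleType.
Variable R : realType.

Definition cycle_coef (j c : nat) : R := (c`!%:R * j.+1%:R ^+ c)^-1.

(** When [weight m = n], [n!] times this is the number of permutations of [n] points with [m j]
    cycles of length [j.+1] for each [j]. *)
Definition cycle_weight (p a : nat) (m : {ffun 'I_p -> 'I_a.+1}) : R :=
  \prod_(j < p) cycle_coef j (m j).

Lemma cycle_coef0 j : cycle_coef j 0 = 1.
Proof. by rewrite /cycle_coef fact0 expr0 mulr1 invr1. Qed.

Lemma cycle_coefS j c :
  (j.+1 * c.+1)%:R * cycle_coef j c.+1 = cycle_coef j c.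
Proof.
rewrite /cycle_coef factS exprS !natrM mulrACA [_.+1%:R * c.+1%:R]mulrC.
by rewrite invfM mulVKf // mulf_neq0 ?pnatr_eq0.
Qed.

(** The bound [N] is separate from [n] so that the recursion on [n] stays inside one finite type. *)
Definition partition_sum (N n : nat) : R :=
  \sum_(m : {ffun 'I_N -> 'I_N.+1} | weight m == n) cycle_weight m.

Definition set_mult N (j : 'I_N) (c : nat -> nat)
    (m : {ffun 'I_N -> 'I_N.+1}) : {ffun 'I_N -> 'I_N.+1} :=
  [ffun i => if i == j then inord (c (m i)) else m i].

Lemma set_mult_neq N (j i : 'I_N) c (m : {ffun 'I_N -> 'I_N.+1}) :
  i != j -> set_mult j c m i = m i.
Proof. by rewrite ffunE => /negPf->. Qed.

Lemma set_mult_eq N (j : 'I_N) (c : nat -> nat)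
    (m : {ffun 'I_N -> 'I_N.+1}) :
  (c (m j) <= N)%N -> set_mult j c m j = c (m j) :> nat.
Proof. by move=> le_c; rewrite ffunE eqxx inordK. Qed.

Lemma weight_set_mult N (j : 'I_N) (c : nat -> nat)
    (m : {ffun 'I_N -> 'I_N.+1}) : (c (m j) <= N)%N ->
  (weight (set_mult j c m) + j.+1 * m j = weight m + j.+1 * c (m j))%N.
Proof.
move=> le_c; rewrite /weight (bigD1 j) //= [in RHS](bigD1 j) //= set_mult_eq //.
rewrite (eq_bigr (fun i : 'I_N => i.+1 * m i)%N); first by lia.
by move=> i ne_ij; rewrite set_mult_neq.
Qed.

(* [inord N.+1] is the junk value [0] of ['I_N.+1]. *)
Lemma set_mult_succ_gt0 N (j : 'I_N) (m : {ffun 'I_N -> 'I_N.+1}) :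
  (0 < set_mult j succn m j)%N = (m j < N)%N.
Proof.
case: (ltnP (m j)) => [lt_mN|le_Nm]; first by rewrite set_mult_eq.
by rewrite ffunE eqxx /inord /insubd insubF // ltnS ltnNge le_Nm.
Qed.

Lemma set_multK N (j : 'I_N) (c d : nat -> nat)
    (m : {ffun 'I_N -> 'I_N.+1}) :
  (c (m j) <= N)%N -> d (c (m j)) = m j ->
  set_mult j d (set_mult j c m) = m.
Proof.
move=> le_c cK; apply/ffunP => i; apply: val_inj => /=.
have [->|ne_ij] := eqVneq i j; last by rewrite !set_mult_neq.
by rewrite !set_mult_eq ?cK // -ltnS.
Qed.

(** Terms with [m j = 0] vanish. On the others, dropping one part [j.+1] is a bijection onto the
    partitions of [n - j.+1], and by [cycle_coefS] the factor [j.+1 * m j] turns the weight of [m]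
    into that of the smaller partition. *)
Lemma remove_part N n (j : 'I_N) : (n <= N)%N ->
  \sum_(m : {ffun 'I_N -> 'I_N.+1} | weight m == n)
     (j.+1 * m j)%:R * cycle_weight m
  = if (j < n)%N then partition_sum N (n - j.+1) else 0.
Proof.
move=> le_nN; rewrite (bigID (fun m : {ffun 'I_N -> 'I_N.+1} => 0 < m j)%N) /=.
rewrite [X in _ + X]big1 ?addr0; last first.
  by move=> m /andP[_]; rewrite -eqn0Ngt => /eqP->; rewrite muln0 mul0r.
case: ifPn => [lt_jn|ge_jn]; last first.
  rewrite big_pred0 // => m; apply/negbTE; apply/negP => /andP[/eqP wm mj].
  by have := leq_weight m j; nia.
pose add_part := set_mult j succn; pose drop_part := set_mult j predn.
rewrite (reindex_onto add_part drop_part); last first.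
  move=> m /andP[_ mj]; apply: set_multK => [|]; last exact: prednK.
  by rewrite (leq_trans (leq_pred _)) // -ltnS.
apply: eq_big => [m|m /andP[/andP[_]]]; last first.
  rewrite set_mult_succ_gt0 => lt_mN _.
  rewrite /cycle_weight (bigD1 j) //= [in RHS](bigD1 j) //=.
  rewrite set_mult_eq // mulrA cycle_coefS.
  by congr (_ * _); apply: eq_bigr => i ne_ij; rewrite set_mult_neq.
rewrite set_mult_succ_gt0.
(* At [m j = N] no part can be added, and [weight m >= N > n - j.+1]: such an [m] is in neither
   index set. *)
have [lt_mN|le_Nm] := ltnP (m j) N; last first.
  rewrite andbF; apply/esym/negbTE/eqP => wm.
  have := leq_weight m j; rewrite wm mulSn => /(leq_trans (leq_addr _ _)) /(leq_trans le_Nm); lia.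
rewrite [drop_part _]set_multK // eqxx !andbT.
have := @weight_set_mult N j succn m lt_mN; rewrite -/(add_part m) mulnS => wE.
by apply/eqP/eqP => wm; move: wE; rewrite wm; lia.
Qed.

Lemma partition_sum_rec N n : (n <= N)%N ->
  n%:R * partition_sum N n = \sum_(j < n) partition_sum N (n - j.+1).
Proof.
move=> le_nN; rewrite /partition_sum mulr_sumr.
under eq_bigr => m /eqP wm do rewrite -{1}wm /weight natr_sum mulr_suml.
rewrite exchange_big /=; under eq_bigr => j _ do rewrite remove_part //.
(* The [if] from [remove_part] cuts the sum over ['I_N] down to [j < n]. *)
by rewrite -big_mkcond -(big_ord_widen _ (fun j => partition_sum N (n - j.+1))).
Qed.

Lemma partition_sum1 N n : (n <= N)%N -> partition_sum N n = 1.
Proof.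
elim/ltn_ind: n => -[_ _|n IHn le_nN].
  rewrite /partition_sum (big_pred1 [ffun=> ord0]) => [|m]; last exact: weight_eq0.
  by apply: big1 => j _; rewrite ffunE cycle_coef0.
have nz : n.+1%:R != 0 :> R by rewrite pnatr_eq0.
apply: (mulfI nz); rewrite partition_sum_rec // mulr1.
rewrite (eq_bigr (fun=> 1)) ?sumr_const ?card_ord // => j _.
by apply: IHn; lia.
Qed.

(** A partition of a positive [n] has at least one part, and at most [n] since every part is at
    least 1. *)
Lemma partition_sum_nparts n : (0 < n)%N ->
  partition_sum n n = \sum_(1 <= k < n.+1)
    \sum_(m : {ffun 'I_n -> 'I_n.+1} | (weight m == n) && (nparts m == k))
      cycle_weight m.
Proof.
move=> n_gt0; under eq_bigr => k _ do rewrite big_mkcond.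
rewrite exchange_big /partition_sum big_mkcond /=; apply: eq_bigr => m _.
case: eqP => [wm|_] /=; last by rewrite big1.
have nm_gt0 : (0 < nparts m)%N.
  rewrite lt0n; apply/eqP => nm; case/eqP: (lt0n_neq0 n_gt0); rewrite -wm.
  apply: big1 => j _; apply/eqP; rewrite muln_eq0 /= -leqn0 -nm.
  exact: leq_nparts.
have nm_lt : (nparts m < n.+1)%N by rewrite ltnS -[leqRHS]wm nparts_weight.
rewrite (big_nat_widenl _ 0) // big_mkord -big_mkcondr /=.
rewrite (big_pred1 (Ordinal nm_lt)) // => k /=.
by apply/andP/eqP => [[_ /eqP nmk]|->]; [apply: val_inj|split].
Qed.

(** Padding with zeros and truncating are mutually inverse between the Bell index and the partitions
    of [n] into [k] parts. *)
Lemma bell_index_cycle_weight n k : (0 < k <= n)%N ->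
  \sum_(m in bell_index n k) cycle_weight m
  = \sum_(m : {ffun 'I_n -> 'I_n.+1} | (weight m == n) && (nparts m == k))
      cycle_weight m.
Proof.
case/andP=> k_gt0 le_kn.
(* Padding fits because [n - k + 1 <= n], by [0 < k], and [k <= n]. *)
have fitsl (m : {ffun 'I_(n - k + 1) -> 'I_k.+1}) : fits n n m.
  by move=> j _; have := ltn_ord j; have := ltn_ord (m j); lia.
have fitsr (m : {ffun 'I_n -> 'I_n.+1}) : weight m = n -> nparts m = k ->
    fits (n - k + 1) k m.
  move=> wm nm j mj; have := part_nparts_weight mj; have := leq_nparts m j.
  by rewrite wm nm; lia.
rewrite [RHS](reindex_onto (@resize (n - k + 1) k n n)
                           (@resize n n (n - k + 1) k)) /=.
  apply: eq_big => [m|m _].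
    rewrite inE resizeK // eqxx andbT andbC /weight /nparts.
    rewrite (big_resize (fitsl m) (fun j c => (j.+1 * c)%N)) //.
      by rewrite (big_resize (fitsl m) (fun _ c => c)).
    by move=> i; rewrite muln0.
  by rewrite /cycle_weight (big_resize (fitsl m)) //; apply: cycle_coef0.
by move=> m /andP[/eqP wm /eqP nm]; rewrite resizeK //; apply: fitsr.
Qed.

(** Since [k] is the sum of the [m j] and [n] that of the [j.+1 * m j], both powers split over [j].
    It remains that [- beta] times the argument over [(j.+1)!] is
    [(- (alpha * beta)) ^+ j.+1 / j.+1]. *)
Lemma bell_term (alpha beta : R) n k (m : {ffun 'I_(n - k + 1) -> 'I_k.+1}) :
  m \in bell_index n k ->
  (- beta) ^+ k * \prod_(j < n - k + 1) (1 / (m j)`!%:R *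
     ((-1) ^+ j * j`!%:R * alpha ^+ j.+1 * beta ^+ j / (j.+1)`!%:R) ^+ m j)
  = (- (alpha * beta)) ^+ n * cycle_weight m.
Proof.
rewrite inE => /andP[/eqP nm /eqP wm].
have expr_k x : x ^+ k = \prod_(j < n - k + 1) x ^+ m j :> R.
  by rewrite -expr_sum nm.
have expr_n x : x ^+ n = \prod_(j < n - k + 1) x ^+ (j.+1 * m j) :> R.
  by rewrite -expr_sum wm.
rewrite expr_k expr_n -!big_split /=; apply: eq_bigr => j _.
rewrite /cycle_coef invfM div1r mulrCA [RHS]mulrCA; congr (_ * _).
rewrite !exprM -exprVn -!exprMn; congr (_ ^+ _).
have nzf : j`!%:R != 0 :> R by rewrite pnatr_eq0 -lt0n fact_gt0.
have nzj : j.+1%:R != 0 :> R by rewrite pnatr_eq0.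
rewrite factS natrM [in RHS]exprNn exprMn !exprS.
(* Made atoms, the factorial and [j.+1] only need to be nonzero for [field]. *)
move: (j`!%:R) (j.+1%:R) nzf nzj => f c nzf nzc.
by field; apply/andP.
Qed.

End CycleType.

Theorem theorem3p1 (R : realType) (alpha beta : R) (n : nat) (hn : (0 < n)%N) :
  \sum_(1 <= k < n.+1)
      (- beta) ^+ k *
      bell_poly n k (fun j : 'I_(n - k + 1) =>
        (-1) ^+ j * j`!%:R * alpha ^+ j.+1 * beta ^+ j)
  = n`!%:R * (- (alpha * beta)) ^+ n.
Proof.
transitivity (n`!%:R * (- (alpha * beta)) ^+ n * partition_sum R n n); last first.
  by rewrite partition_sum1 // mulr1.
rewrite partition_sum_nparts // mulr_sumr !big_nat; apply: eq_bigr => k le_kn.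
rewrite -bell_index_cycle_weight // /bell_poly mulrCA -mulrA; congr (_ * _).
by rewrite !mulr_sumr; apply: eq_bigr => m; apply: bell_term.
Qed.
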